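(* The following statements are equivalent: (1) for every PCSP template $(\mathbf A,\mathbf B)$ of finite structures such that $\mathrm{Pol}(\mathbf A,\mathbf B)$ contains no Siggers function, $\mathrm{PCSP}(\mathbf A,\mathbf B)$ is NP-hard; (2) $\mathrm{PCSP}(\mathbf K_k,\mathbf K_c)$ is NP-hard for all $c\ge k\ge3$; (3) $\mathrm{PCSP}(\mathbf K_3,\mathbf K_c)$ is NP-hard for each $c\ge3$.
   Context: $\mathbf K_n$ has domain $\{0,\dots,n-1\}$ and the binary relation $\ne$. PCSP template: similar finite relational structures $\mathbf A\to\mathbf B$; $\mathrm{PCSP}(\mathbf A,\mathbf B)$: given $\mathbf I$, answer YES if $\mathbf I\to\mathbf A$, NO if $\mathbf I\not\to\mathbf B$. $\mathrm{Pol}(\mathbf A,\mathbf B)$: all homomorphisms $\mathbf A^n\to\mathbf B$ with $\mathbf A^n$ the power structure (relations consist of rows of matrices whose columns lie in the relations of $\mathbf A$). A Siggers function is a $6$-ary $s$ with $s(x,y,x,z,y,z)=s(y,x,z,x,z,y)$ for all $x,y,z$. *)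

(* Defs.v *)
From mathcomp Require Import all_boot.

Set Implicit Arguments.
Unset Strict Implicit.
Unset Printing Implicit Defensive.

(** * Finite relational structures, homomorphisms, polymorphisms *)

Record signature := Signature {
  symbol :> finType;
  arity : symbol -> nat
}.

Record structure (sg : signature) := Structure {
  dom :> finType;
  interp : forall R : sg, {set (arity R).-tuple dom}
}.

Definition is_hom (sg : signature) (A B : structure sg) (f : A -> B) : Prop :=
  forall (R : sg) (t : (arity R).-tuple A),
    t \in interp A R -> map_tuple f t \in interp B R.

Definition maps_to (sg : signature) (A B : structure sg) : Prop :=
  exists f : A -> B, is_hom f.

(* The entries of [t] are the rows of an [arity R] x [n] matrix over [A];
   column [j] collects their [j]-th coordinates. *)
Definition power (sg : signature) (A : structure sg) (n : nat) : structure sg :=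
  @Structure sg (n.-tuple A : finType) (fun R =>
    [set t : (arity R).-tuple (n.-tuple A) |
      [forall j : 'I_n,
        map_tuple (fun a : n.-tuple A => tnth a j) t \in interp A R]]).

Definition Pol (sg : signature) (A B : structure sg) (n : nat)
    (f : n.-tuple A -> B) : Prop :=
  @is_hom sg (power A n) B f.

Definition siggers (A B : Type) (s : 6.-tuple A -> B) : Prop :=
  forall x y z : A,
    s [tuple x; y; x; z; y; z] = s [tuple y; x; z; x; z; y].

Definition graph_sig : signature := @Signature unit (fun=> 2).

Definition K (n : nat) : structure graph_sig :=
  @Structure graph_sig 'I_n (fun=>
    [set t : 2.-tuple 'I_n | tnth t ord0 != tnth t ord_max]).

(** * Polynomial time: deterministic multi-tape Turing machines *)

(* [None] is the blank symbol, both here and as a tape cell. *)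
Definition cell := option bool.

(* A two-way infinite tape: [tleft] is read away from the head, and the cells
   beyond both lists are blank. *)
Record tape := Tape { tleft : seq cell; thead : cell; tright : seq cell }.

Inductive direction := MoveL | Stay | MoveR.

Definition update_tape (a : cell) (m : direction) (t : tape) : tape :=
  match m with
  | MoveL => Tape (behead (tleft t)) (head None (tleft t)) (a :: tright t)
  | Stay => Tape (tleft t) a (tright t)
  | MoveR => Tape (a :: tleft t) (head None (tright t)) (behead (tright t))
  end.

(* [delta q s = None] means that the machine halts in state [q] when it
   scans the symbols [s]. *)
Record machine := Machine {
  tapes : finType;
  input_tape : tapes;
  output_tape : tapes;
  state : finType;
  start : state;
  delta : state -> {ffun tapes -> cell} ->
          option (state * {ffun tapes -> cell * direction})
}.

Definition config (M : machine) : Type := (state M * {ffun tapes M -> tape})%type.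

Definition step (M : machine) (c : config M) : option (config M) :=
  if delta c.1 [ffun i => thead (c.2 i)] is Some (q, a)
  then Some (q, [ffun i => update_tape (a i).1 (a i).2 (c.2 i)])
  else None.

Definition halted (M : machine) (c : config M) : Prop := step c = None.

(* A halted configuration is left unchanged. *)
Definition run (M : machine) (n : nat) (c : config M) : config M :=
  iter n (fun c => odflt c (step c)) c.

Definition word := seq bool.

Definition tape_of_word (w : word) : tape :=
  Tape [::] (ohead w) (map Some (behead w)).

Definition initial (M : machine) (w : word) : config M :=
  (start M,
   [ffun i => if i == input_tape M then tape_of_word w else tape_of_word [::]]).

Fixpoint read (s : seq cell) : word :=
  if s is Some b :: s' then b :: read s' else [::].

(* The output is the maximal blank-free word starting at the head. *)
Definition output (M : machine) (c : config M) : word :=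
  let t := c.2 (output_tape M) in read (thead t :: tright t).

Definition polytime (f : word -> word) : Prop :=
  exists (M : machine) (a d : nat), forall w : word,
    let c := run (a * size w ^ d + a) (initial M w) in
    halted c /\ output c = f w.

(** * NP and NP-hardness of promise problems *)

(* Each bit of [x] is preceded by [true]; [false] marks the end of [x]. *)
Definition pair_word (x y : word) : word :=
  foldr (fun b s => [:: true, b & s]) (false :: y) x.

Definition in_NP (L : word -> Prop) : Prop :=
  exists (V : word -> word) (a d : nat),
    polytime V /\
    forall x : word,
      L x <-> exists y : word,
        size y <= a * size x ^ d + a /\ V (pair_word x y) = [:: true].

Record promise_problem := PromiseProblem {
  yes_instance : word -> Prop;
  no_instance : word -> Prop
}.

Definition NP_hard (P : promise_problem) : Prop :=
  forall L : word -> Prop, in_NP L ->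
    exists f : word -> word,
      [/\ polytime f,
          forall w, L w -> yes_instance P (f w) &
          forall w, ~ L w -> no_instance P (f w)].

(** * Promise constraint satisfaction problems *)

(* An input structure has domain {0, ..., n-1} and is given by a list of its
   facts (a relation symbol and a tuple in its interpretation). *)
Definition fact (sg : signature) (n : nat) : Type :=
  {R : sg & (arity R).-tuple 'I_n}.

Definition structure_of_facts (sg : signature) (n : nat) (s : seq (fact sg n)) :
    structure sg :=
  @Structure sg 'I_n (fun R =>
    [set t : (arity R).-tuple 'I_n |
      Tagged (fun R => (arity R).-tuple 'I_n) t \in s]).

Definition encode_nat (k : nat) : word := rcons (nseq k true) false.

Definition encode_fact (sg : signature) (n : nat) (c : fact sg n) : seq nat :=
  (enum_rank (tag c) : nat) :: map val (tagged c).

(* The domain size followed by the facts, all numbers in unary; the length is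
   polynomially related to [n + size s], and the fixed arities make the code
   uniquely decodable. *)
Definition encode (sg : signature) (n : nat) (s : seq (fact sg n)) : word :=
  flatten (map encode_nat (n :: flatten (map (@encode_fact sg n) s))).

Definition PCSP (sg : signature) (A B : structure sg) : promise_problem :=
  PromiseProblem
    (fun w => exists (n : nat) (s : seq (fact sg n)),
       w = encode s /\ maps_to (structure_of_facts s) A)
    (fun w => exists (n : nat) (s : seq (fact sg n)),
       w = encode s /\ ~ maps_to (structure_of_facts s) B).

(* Main.v *)
Require Import Defs.
From mathcomp Require Import all_boot zify.
From Stdlib Require Import Classical.

Set Implicit Arguments.
Unset Strict Implicit.
Unset Printing Implicit Defensive.

(** The equivalence of (2) and (3) and the implication from (1) to (2) are
    direct: K_3 maps to K_k, and a Siggers function in Pol(K_k, K_c) would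
    send two adjacent vertices of the sixth power of K_k to the same colour.

    For (2) implies (1), let the vertices of a graph F be the maps from A^3
    to B, with g and h adjacent when there is a 6-ary polymorphism s with
    g(x,y,z) = s(x,y,x,z,y,z) and h(x,y,z) = s(y,x,z,x,z,y).  Without a Siggers
    function F has no loop, so it is c-colourable for c >= |F|.  A graph G is
    sent to the instance made of one copy of A^3 for each vertex and one copy
    of the power structure A^6 for each edge (u,v), where (x,y,x,z,y,z) is
    identified with the triple (x,y,z) of u and (y,x,z,x,z,y) with the triple
    (x,y,z) of v.  A 3-colouring of G yields coordinate projections of the
    instance to A, and a homomorphism of the instance to B yields a
    homomorphism from G to F.  The constant tuples of all the copies are
    identified as well; the identifications then need no transitive closure,
    and each edge can be translated locally by a Turing machine, which runs
    after the machine of the given reduction to PCSP(K_3, K_c). *)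

(** * Composing Turing machines *)

Section Fragments.

Variable K : finType.

Definition memory := {ffun K -> tape}.

Definition scan (T : memory) : {ffun K -> cell} := [ffun i => Defs.thead (T i)].

Definition act (a : {ffun K -> cell * direction}) (T : memory) : memory :=
  [ffun i => update_tape (a i).1 (a i).2 (T i)].

Definition idle (h : {ffun K -> cell}) : {ffun K -> cell * direction} :=
  [ffun i => (h i, Stay)].

(* A program with exits labelled by [E]: [bind] continues according to the exit
   label, [repeat] restarts on [None]. *)
Record fragment (E : Type) := Fragment {
  fstate : finType;
  fentry : fstate;
  fnext : fstate -> {ffun K -> cell} ->
          (fstate + E) * {ffun K -> cell * direction}
}.

Inductive steps E (F : fragment E) :
    fstate F -> memory -> nat -> E -> memory -> Prop :=
| StepsExit s T e a : fnext s (scan T) = (inr e, a) -> steps s T 1 e (act a T)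
| StepsNext s T s' a n e T' : fnext s (scan T) = (inl s', a) ->
    steps s' (act a T) n e T' -> steps s T n.+1 e T'.

Definition exec E (F : fragment E) := steps (fentry F).

Definition prim E
    (p : {ffun K -> cell} -> E * {ffun K -> cell * direction}) : fragment E :=
  @Fragment E unit tt (fun _ h => (inr (p h).1, (p h).2)).

Definition skip E (e : E) : fragment E := prim (fun h => (e, idle h)).

Definition bind (E : finType) E' (F : fragment E) (G : E -> fragment E') :
    fragment E' :=
  @Fragment E' (fstate F + {e : E & fstate (G e)})%type (inl (fentry F))
    (fun s h => match s with
     | inl s1 => match fnext s1 h with
       | (inl s', a) => (inl (inl s'), a)
       | (inr e, a) =>
         (inl (inr (Tagged (fun e => fstate (G e)) (fentry (G e)))), a)
       end
     | inr s2 => match fnext (tagged s2) h with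
       | (inl s', a) => (inl (inr (Tagged (fun e => fstate (G e)) s')), a)
       | (inr e, a) => (inr e, a)
       end
     end).

Definition seqf E (F : fragment unit) (G : fragment E) := bind F (fun=> G).

Definition repeat E (F : fragment (option E)) : fragment E :=
  @Fragment E (fstate F) (fentry F)
    (fun s h => match fnext s h with
     | (inl s', a) => (inl s', a)
     | (inr (Some e), a) => (inr e, a)
     | (inr None, a) => (inl (fentry F), a)
     end).

Lemma act_idle T : act (idle (scan T)) T = T.
Proof. by apply/ffunP=> i; rewrite !ffunE /=; case: (T i). Qed.

Lemma exec_prim E (p : _ -> E * _) T :
  exec (prim p) T 1 (p (scan T)).1 (act (p (scan T)).2 T).
Proof. exact: StepsExit. Qed.

Lemma exec_skip E (e : E) T : exec (skip e) T 1 e T.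
Proof. by have := exec_prim (fun h => (e, idle h)) T; rewrite /= act_idle. Qed.

Lemma exec_bind (E : finType) E' (F : fragment E) (G : E -> fragment E')
    T n e T' m e' T'' :
  exec F T n e T' -> exec (G e) T' m e' T'' ->
  exec (bind F G) T (n + m) e' T''.
Proof.
rewrite /exec /=; elim=> {n e T'}[s T0 e a Fs|s T0 s' a n e T' Fs _ IH] Gm.
  apply: (@StepsNext _ (bind F G) (inl s)).
    by rewrite /= Fs.
  elim: Gm => {T0 m e' T'' Fs}[s2 T0 e' a2 Gs|s2 T0 s3 a2 m e' T'' Gs _ IH2].
    by apply: StepsExit; rewrite /= Gs.
  by apply: StepsNext IH2; rewrite /= Gs.
by apply: (@StepsNext _ (bind F G) (inl s)) (IH Gm); rewrite /= Fs.
Qed.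

Lemma exec_seqf E (F : fragment unit) (G : fragment E) T n T' m e T'' :
  exec F T n tt T' -> exec G T' m e T'' -> exec (seqf F G) T (n + m) e T''.
Proof. exact: exec_bind. Qed.

Lemma exec_repeat_exit E (F : fragment (option E)) T n e T' :
  exec F T n (Some e) T' -> exec (repeat F) T n e T'.
Proof.
rewrite /exec /=; move De: (Some e) => oe Fn.
elim: Fn De => {n oe T'}[s T0 e0 a Fs|s T0 s' a n e0 T' Fs _ IH] De.
  by apply: (@StepsExit _ (repeat F)); rewrite /= Fs -De.
by apply: (@StepsNext _ (repeat F)) (IH De); rewrite /= Fs.
Qed.

Lemma exec_repeat_next E (F : fragment (option E)) T n T' m e T'' :
  exec F T n None T' -> exec (repeat F) T' m e T'' ->
  exec (repeat F) T (n + m) e T''.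
Proof.
rewrite {1 3}/exec /=; move De: None => oe Fn Gm.
elim: Fn De Gm => {n oe T'}[s T0 e0 a Fs|s T0 s' a n e0 T' Fs _ IH] De Gm.
  by apply: (@StepsNext _ (repeat F)) Gm; rewrite /= Fs -De.
by apply: (@StepsNext _ (repeat F)) (IH De Gm); rewrite /= Fs.
Qed.

(** The extra state [None] has no transition: leaving the fragment means halting, and any larger
    number of steps gives the same configuration. *)
Definition machine_of (i o : K) (F : fragment unit) : machine :=
  @Machine K i o (option (fstate F)) (Some (fentry F))
    (fun s h => if s is Some s1 then
       match fnext s1 h with
       | (inl s', a) => Some (Some s', a)
       | (inr _, a) => Some (None, a)
       end else None).

Lemma run_machine_of (i o : K) (F : fragment unit) T n T' N :
  exec F T n tt T' -> n <= N ->
  run N ((Some (fentry F), T) : config (machine_of i o F)) = (None, T').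
Proof.
rewrite /exec => Fn /subnK <-; rewrite addnC; move: (N - n) => k.
have stuck T0 :
    run k ((None, T0) : config (machine_of i o F)) = (None, T0).
  by elim: k => //= k ->.
elim: Fn => {n T'}[s T0 e a Fs|s T0 s' a n e T' Fs _ IH].
  rewrite addnC addn1 /run iterSr /= -[LHS]/(run k _) /step /= -/(scan T0) Fs /=.
  exact: stuck.
rewrite addSn /run iterSr /= -[LHS]/(run (n + k) _).
by rewrite /step /= -/(scan T0) Fs /= IH.
Qed.

End Fragments.

(** * Tapes as stacks *)

Section Stacks.

Variables L J : finType.

Notation K := (L + J)%type.

(* A stack is stored with its top just to the left of the head; a tape which
   has been used may carry explicit blanks beyond its content. *)
Definition is_stack (t : tape) (s : word) : Prop :=
  exists k l, t = Tape (map Some s ++ nseq k None) None (nseq l None).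

Definition stores (T : memory K) (z : J -> word) : Prop :=
  forall j, is_stack (T (inr j)) (z j).

Definition upd (X : Type) (z : J -> X) (j : J) (x : X) : J -> X :=
  fun i => if i == j then x else z i.

(** A total-correctness triple with a time bound. It ranges over all memories that store [z], since
    the blank padding may vary, and leaves the tapes in [L] unconstrained. *)
Variant does E (F : fragment K E) z n e z' : Prop :=
  Does of forall T, stores T z ->
    exists m T', [/\ m <= n, exec F T m e T' & stores T' z'].

Definition move_on (j : J) (x : cell * direction) (h : {ffun K -> cell}) :
    {ffun K -> cell * direction} :=
  [ffun i => if i == inr j then x else (h i, Stay)].

Definition push j b : fragment K unit :=
  prim (fun h => (tt, move_on j (Some b, MoveR) h)).

(** The first action steps onto the top of the stack. A blank there means that the stack is empty,
    and the head moves back; otherwise the bit is erased in place. *)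
Definition pop j : fragment K (option bool) :=
  seqf (prim (fun h => (tt, move_on j (None, MoveL) h)))
    (prim (fun h => (h (inr j),
      move_on j (None, if h (inr j) is None then MoveR else Stay) h))).

Lemma act_move_on (j : J) x (T : memory K) i :
  act (move_on j x (scan T)) T i =
  if i == inr j then update_tape x.1 x.2 (T i) else T i.
Proof. by rewrite !ffunE; case: eqP => //= _; case: (T i). Qed.

Lemma doesW E (F : fragment K E) z n e z' n0 z1 :
  does F z n e z' -> n <= n0 -> z' =1 z1 -> does F z n0 e z1.
Proof.
move=> [dF] nn0 z'z1; split=> T /dF[m [T' [mn FT Tz']]].
by exists m, T'; split=> [||j]; rewrite -?z'z1 //; apply: leq_trans nn0.
Qed.

Lemma does_pre E (F : fragment K E) z n e z' z0 :
  does F z n e z' -> z0 =1 z -> does F z0 n e z'.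
Proof. by move=> [dF] z0z; split=> T Tz; apply: dF => j; rewrite -z0z. Qed.

Lemma does_ext E (F : fragment K E) z n e z' z1 :
  does F z n e z' -> z' =1 z1 -> does F z n e z1.
Proof. by move=> dF; apply: doesW dF _. Qed.

Lemma does_bind (E : finType) E' (F : fragment K E) (G : E -> fragment K E')
    z n e z' m e' z'' :
  does F z n e z' -> does (G e) z' m e' z'' ->
  does (bind F G) z (n + m) e' z''.
Proof.
move=> [dF] [dG]; split=> T /dF[n1 [T1 [n1n FT /dG[m1 [T2 [m1m GT Tz]]]]]].
by exists (n1 + m1), T2; split=> //; [apply: leq_add | apply: exec_bind GT].
Qed.

Lemma does_seqf E (F : fragment K unit) (G : fragment K E) z n z' m e z'' :
  does F z n tt z' -> does G z' m e z'' -> does (seqf F G) z (n + m) e z''.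
Proof. exact: does_bind. Qed.

Lemma does_skip E (e : E) z : does (skip K e) z 1 e z.
Proof. by split=> T Tz; exists 1, T; split=> //; apply: exec_skip. Qed.

Lemma does_repeat_exit E (F : fragment K (option E)) z n e z' :
  does F z n (Some e) z' -> does (repeat F) z n e z'.
Proof.
move=> [dF]; split=> T /dF[m [T' [mn FT Tz]]]; exists m, T'.
by split=> //; apply: exec_repeat_exit.
Qed.

Lemma does_repeat_next E (F : fragment K (option E)) z n z' m e z'' :
  does F z n None z' -> does (repeat F) z' m e z'' ->
  does (repeat F) z (n + m) e z''.
Proof.
move=> [dF] [dG]; split=> T /dF[n1 [T1 [n1n FT /dG[m1 [T2 [m1m GT Tz]]]]]].
exists (n1 + m1), T2; split=> //; first exact: leq_add.
exact: exec_repeat_next GT.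
Qed.

Lemma stores_act_move_on z j x s T :
  stores T z -> is_stack (update_tape x.1 x.2 (T (inr j))) s ->
  stores (act (move_on j x (scan T)) T) (upd z j s).
Proof.
move=> Tz js i; rewrite act_move_on /upd.
by have [->|ij] := eqVneq i j; rewrite ?eqxx //= ifN //; apply: contra_neq ij => -[].
Qed.

Lemma does_push j b z : does (push j b) z 1 tt (upd z j (b :: z j)).
Proof.
split=> T Tz; exists 1; eexists; split; [by []|exact: exec_prim|].
apply: stores_act_move_on => //; have [k [l ->]] := Tz j.
by exists k, l.-1; case: l.
Qed.

Lemma does_pop j z : does (pop j) z 2 (ohead (z j)) (upd z j (behead (z j))).
Proof.
split=> T Tz; exists 2.
set T1 := act (move_on j (None, MoveL) (scan T)) T.
have ET1 : T1 (inr j) = update_tape None MoveL (T (inr j)).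
  by rewrite act_move_on eqxx.
have T1i i : i != j -> T1 (inr i) = T (inr i).
  by move=> ij; rewrite act_move_on ifN //; apply: contra_neq ij => -[].
have -> : ohead (z j) = scan T1 (inr j).
  rewrite ffunE ET1; have [k [l ->]] := Tz j.
  by case: (z j) => [|b s] //=; case: k.
eexists; split; [by []|exact: (exec_bind (exec_prim _ _) (exec_prim _ _))|].
move=> i /=.
rewrite -/T1 act_move_on /upd.
have [->|ij] := eqVneq i j; last first.
  by rewrite ifN ?T1i //; apply: contra_neq ij => -[].
rewrite eqxx /= ffunE ET1; have [k [l ->]] := Tz j.
case: (z j) => [|b s] /=; last by exists k, l.+1.
by exists k.-1.+1, l; case: k.
Qed.

End Stacks.

(** * Loops on stacks and the registers of the translation *)

Section Programs.

Variables L J : finType.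

Notation frag := (fragment (L + J)%type).

Definition pushes j (w : word) : frag unit :=
  foldr (fun b F => seqf (push L j b) F) (skip _ tt) w.

Definition while j (body : bool -> frag unit) : frag unit :=
  repeat (bind (pop L j) (fun o =>
    if o is Some b then seqf (body b) (skip _ None) else skip _ (Some tt))).

Lemma upd_upd (X : Type) (z : J -> X) j x y : upd (upd z j x) j y =1 upd z j y.
Proof. by move=> i; rewrite /upd; case: eqP. Qed.

Lemma upd_id (X : Type) (z : J -> X) j x : z j = x -> upd z j x =1 z.
Proof. by move=> zj i; rewrite /upd; case: eqP => [->|]. Qed.

Lemma does_pushes j w z :
  does (pushes j w) z (size w).+1 tt (upd z j (rev w ++ z j)).
Proof.
elim: w z => [|b w IH] z /=.
  by apply: does_ext (does_skip _ _ _) _ => i; rewrite upd_id.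
apply: doesW (does_seqf (does_push _ _ _ _) (IH _)) _ _ => // i.
by rewrite upd_upd /upd eqxx rev_cons cat_rcons.
Qed.

Lemma does_while_nil j body z : z j = [::] -> does (while j body) z 3 tt z.
Proof.
move=> zj; apply: does_repeat_exit.
have dS : does (if ohead (z j) is Some b
    then seqf (body b) (skip _ None) else skip _ (Some tt))
    (upd z j (behead (z j))) 1 (Some tt) (upd z j (behead (z j))).
  by rewrite zj; apply: does_skip.
apply: does_ext (does_bind (does_pop _ _ _) dS) _ => i.
by rewrite upd_id // zj.
Qed.

Lemma does_while_cons j body z b s n z1 m z2 : z j = b :: s ->
  does (body b) (upd z j s) n tt z1 -> does (while j body) z1 m tt z2 ->
  does (while j body) z (n + m + 3) tt z2.
Proof.
move=> zj dF dW; have -> : n + m + 3 = (2 + (n + 1)) + m by lia.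
apply: does_repeat_next dW; apply: does_bind; first exact: does_pop.
by rewrite zj /=; apply: does_seqf dF _; apply: does_skip.
Qed.

End Programs.

Definition blockId := 'I_3.
Definition stackId := (blockId + 'I_3)%type.

(* The two tapes [stX] and [stY] hold words, [stO] the reversed output; the
   tapes in [blockId] hold unary numbers. *)
Definition stX : stackId := inr (@Ordinal 3 0 isT).
Definition stY : stackId := inr (@Ordinal 3 1 isT).
Definition stO : stackId := inr (@Ordinal 3 2 isT).

Definition stacks (x y o : word) (a : blockId -> nat) : stackId -> word :=
  fun j => match j with
  | inl b => nseq (a b) true
  | inr i => nth [::] [:: x; y; o] i
  end.

Definition triple (u v e : nat) : blockId -> nat := fun b => nth 0 [:: u; v; e] b.

Definition blockU : blockId := @Ordinal 3 0 isT.
Definition blockV : blockId := @Ordinal 3 1 isT.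
Definition blockE : blockId := @Ordinal 3 2 isT.

Lemma stacks_ext x y o a a' : a =1 a' -> stacks x y o a =1 stacks x y o a'.
Proof. by move=> aa' [b|i] //=; rewrite aa'. Qed.

Lemma upd_stX x y o a s : upd (stacks x y o a) stX s =1 stacks s y o a.
Proof. by case=> [b|[[|[|[|i]]] lti]]. Qed.

Lemma upd_stY x y o a s : upd (stacks x y o a) stY s =1 stacks x s o a.
Proof. by case=> [b|[[|[|[|i]]] lti]]. Qed.

Lemma upd_stO x y o a s : upd (stacks x y o a) stO s =1 stacks x y s a.
Proof. by case=> [b|[[|[|[|i]]] lti]]. Qed.

Lemma upd_block x y o a b n :
  upd (stacks x y o a) (inl b) (nseq n true) =1 stacks x y o (upd a b n).
Proof.
case=> [b'|i] //; rewrite /upd /= (inj_eq (_ : injective inl)) => [|c d []//].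
by case: eqP.
Qed.

Lemma triple_updU u v e n : upd (triple u v e) blockU n =1 triple n v e.
Proof. by case=> [[|[|[|i]]] lti]. Qed.

Lemma triple_updV u v e n : upd (triple u v e) blockV n =1 triple u n e.
Proof. by case=> [[|[|[|i]]] lti]. Qed.

Lemma triple_updE u v e n : upd (triple u v e) blockE n =1 triple u v n.
Proof. by case=> [[|[|[|i]]] lti]. Qed.

(** * The machine that translates a graph *)

Section Gadget.

Variables (L : finType) (C : nat).

Notation frag := (fragment (L + stackId)%type).

(** A variable has the number [C * block + slot]; in unary this is a multiple of a register followed
    by a fixed word, hence the two kinds of instruction. *)
Definition instr := (word + blockId)%type.

Definition instr_out (a : blockId -> nat) (i : instr) : word :=
  match i with inl w => w | inr b => nseq (C * a b) true end.

(** A [while] would consume the whole stack; this loop stops at the [false] that ends a unary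
    number. *)
Definition read_nat b : frag unit :=
  repeat (bind (pop L stY) (fun o =>
    if o == Some true then seqf (push L (inl b) true) (skip _ None)
    else skip _ (Some tt))).

Definition clear b : frag unit := while (inl b) (fun=> skip _ tt).

(** Reading a unary register destroys it, so it is moved to the scratch stack [stX] during the
    output and then moved back. *)
Definition emit_block b : frag unit :=
  seqf (while (inl b) (fun=>
          seqf (push L stX true) (pushes _ stO (nseq C true))))
       (while stX (fun=> push L (inl b) true)).

Definition emit (i : instr) : frag unit :=
  match i with inl w => pushes _ stO w | inr b => emit_block b end.

Definition emits (l : seq instr) : frag unit :=
  foldr (fun i F => seqf (emit i) F) (skip _ tt) l.

Lemma does_push_block b x y o a :
  does (push L (inl b) true) (stacks x y o a) 1 tt
    (stacks x y o (upd a b (a b).+1)).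
Proof. by apply: does_ext (does_push _ _ _ _) _ => i; rewrite -upd_block. Qed.

Lemma does_pushes_out w x y o a :
  does (pushes L stO w) (stacks x y (rev o) a) (size w).+1 tt
    (stacks x y (rev (o ++ w)) a).
Proof.
by apply: does_ext (does_pushes _ _ _ _) _ => i; rewrite upd_stO /= rev_cat.
Qed.

Lemma does_while_X body c x y o a n z1 m z2 :
  does (body c) (stacks x y o a) n tt z1 -> does (while stX body) z1 m tt z2 ->
  does (@while L _ stX body) (stacks (c :: x) y o a) (n + m + 3) tt z2.
Proof.
move=> dF; apply: does_while_cons => //.
by apply: does_pre dF _ => i; rewrite upd_stX.
Qed.

Lemma does_while_block body b x y o a k n z1 m z2 : a b = k.+1 ->
  does (body true) (stacks x y o (upd a b k)) n tt z1 ->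
  does (while (inl b) body) z1 m tt z2 ->
  does (@while L _ (inl b) body) (stacks x y o a) (n + m + 3) tt z2.
Proof.
move=> ab dF; apply: (@does_while_cons _ _ _ _ _ true (nseq k true)).
  by rewrite /= ab.
by apply: does_pre dF _ => i; rewrite upd_block.
Qed.

Lemma does_read_nat b x n y o a :
  does (read_nat b) (stacks x (encode_nat n ++ y) o a) (4 * n + 3) tt
    (stacks x y o (upd a b (n + a b))).
Proof.
elim: n a => [|n IH] a; set z := stacks x (encode_nat _ ++ y) o a.
  apply: does_repeat_exit.
  have dS : does (if ohead (z stY) == Some true
      then seqf (push L (inl b) true) (skip _ None) else skip _ (Some tt))
      (upd z stY (behead (z stY))) 1 (Some tt) (upd z stY (behead (z stY))).
    exact: does_skip.
  apply: doesW (does_bind (does_pop _ _ _) dS) _ _ => // i.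
  by rewrite upd_stY; apply: stacks_ext => b'; rewrite upd_id.
have dS : does (if ohead (z stY) == Some true
    then seqf (push L (inl b) true) (skip _ None) else skip _ (Some tt))
    (upd z stY (behead (z stY))) (1 + 1) None
    (stacks x (encode_nat n ++ y) o (upd a b (a b).+1)).
  apply: does_seqf (does_skip _ _ _).
  by apply: does_pre (does_push_block _ _ _ _ _) _ => i; rewrite upd_stY.
apply: doesW (does_repeat_next (does_bind (does_pop _ _ _) dS) (IH _)) _ _.
  by lia.
by apply: stacks_ext => b'; rewrite upd_upd /upd eqxx addnS.
Qed.

Lemma does_clear b x y o a :
  does (clear b) (stacks x y o a) (4 * a b + 3) tt (stacks x y o (upd a b 0)).
Proof.
move Ek: (a b) => k; elim: k a Ek => [|k IH] a ab.
  apply: does_ext (does_while_nil _ _) _; first by rewrite /= ab.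
  by apply: stacks_ext => b'; rewrite upd_id.
apply: doesW (does_while_block ab (does_skip _ _ _) (IH _ _)) _ _.
- by rewrite /upd eqxx.
- by lia.
- by apply: stacks_ext => b'; rewrite upd_upd.
Qed.

Lemma does_emit_block b y o a :
  does (emit_block b) (stacks [::] y (rev o) a) ((C + 9) * a b + 6) tt
    (stacks [::] y (rev (o ++ nseq (C * a b) true)) a).
Proof.
have down k p o' a' : a' b = k ->
    does (while (inl b) (fun=>
          seqf (push L stX true) (pushes _ stO (nseq C true))))
      (stacks (nseq p true) y (rev o') a') ((C + 5) * k + 3) tt
      (stacks (nseq (k + p) true) y (rev (o' ++ nseq (C * k) true))
         (upd a' b 0)).
  elim: k p o' a' => [|k IH] p o' a' a'b.
    rewrite !muln0 cats0.
    apply: does_ext (does_while_nil _ _) _; first by rewrite /= a'b.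
    by apply: stacks_ext => b'; rewrite upd_id.
  apply: doesW (does_while_block a'b (does_seqf (does_push _ _ _ _)
    (does_pre (does_pushes_out _ (nseq p.+1 true) _ _ _) _))
    (IH p.+1 _ _ _)) _ _.
  - by move=> i; rewrite upd_stX.
  - by rewrite /upd eqxx.
  - by rewrite size_nseq; lia.
  - move=> i; rewrite -catA -nseqD mulnS addnS.
    by apply: stacks_ext => b'; rewrite upd_upd.
have up p o' a' :
    does (while stX (fun=> push L (inl b) true))
      (stacks (nseq p true) y o' a') (4 * p + 3) tt
      (stacks [::] y o' (upd a' b (p + a' b))).
  elim: p a' => [|p IH] a'.
    apply: does_ext (does_while_nil _ _) _; first by [].
    by apply: stacks_ext => b'; rewrite upd_id.
  rewrite [nseq _ _]/=.
  apply: doesW (does_while_X (body := fun=> push L (inl b) true)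
    (does_push_block _ _ _ _ _) (IH _)) _ _ => //.
    by lia.
  by apply: stacks_ext => b'; rewrite upd_upd /upd eqxx addnS.
apply: doesW (does_seqf (down (a b) 0 _ _ _) (up _ _ _)) _ _ => //.
  by lia.
apply: stacks_ext => b'; rewrite upd_upd {2}/upd eqxx addn0 addn0.
exact: upd_id.
Qed.

(** Every instruction takes time linear in the largest register; the coefficients are added up, and
    the final [1] pays for [skip]. *)
Definition cost (l : seq instr) : nat :=
  foldr (fun i c => (if i is inl w then size w + 1 else C + 15) + c) 1 l.

Lemma does_emits l s y o a : (forall b, a b <= s) ->
  does (emits l) (stacks [::] y (rev o) a) (cost l * s.+1) tt
    (stacks [::] y (rev (o ++ flatten (map (instr_out a) l))) a).
Proof.
move=> a_s; elim: l o => [|i l IH] o /=.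
  by rewrite cats0; apply: doesW (does_skip _ _ _) _ _ => //; lia.
rewrite catA mulnDl; apply: does_seqf (IH _).
case: i => [w|b] /=.
  by apply: doesW (does_pushes_out _ _ _ _ _) _ _ => //; nia.
by apply: doesW (does_emit_block _ _ _ _) _ _ => //; have := a_s b; nia.
Qed.

Variable l : seq instr.

(** The increments turn a vertex [v] into its block number [v.+1]. Clearing the two registers
    prepares for the next edge, which receives the next edge block. *)
Definition edge_frag : frag unit :=
  seqf (read_nat blockU) (seqf (push L (inl blockU) true)
  (seqf (read_nat blockV) (seqf (push L (inl blockV) true)
  (seqf (emits l) (seqf (clear blockU) (seqf (clear blockV)
  (push L (inl blockE) true))))))).

(** The leading [false] is the unary code of [0], the rank of the only relation symbol of graphs. *)
Definition edge_word (e : nat * nat) : word :=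
  false :: encode_nat e.1 ++ encode_nat e.2.

Definition graph_word n (es : seq (nat * nat)) : word :=
  encode_nat n ++ flatten (map edge_word es).

Definition graph_ok n (es : seq (nat * nat)) : Prop :=
  forall e, e \in es -> (e.1 < n) && (e.2 < n).

(** Block numbers are thus bounded by the length of the input, from which the number of variables is
    computed. *)
Lemma size_graph_word n (es : seq (nat * nat)) :
  n + 1 + 3 * size es <= size (graph_word n es).
Proof.
rewrite size_cat size_rcons size_nseq addn1 leq_add2l.
elim: es => //= e es IH; rewrite size_cat !size_cat !size_rcons.
by lia.
Qed.

Fixpoint edges_out k (es : seq (nat * nat)) : word :=
  if es is e :: es' then
    flatten (map (instr_out (triple e.1.+1 e.2.+1 k)) l) ++ edges_out k.+1 es'
  else [::].

Lemma does_edge s u v k y o : u < s -> v < s -> k <= s ->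
  does edge_frag (stacks [::] (encode_nat u ++ encode_nat v ++ y) (rev o)
      (triple 0 0 k)) ((cost l + 40) * s.+1) tt
    (stacks [::] y (rev (o ++ flatten (map (instr_out (triple u.+1 v.+1 k)) l)))
       (triple 0 0 k.+1)).
Proof.
move=> us vs ks.
pose st y' o' u' v' k' := stacks [::] y' (rev o') (triple u' v' k').
have readU n v' y' : does (read_nat blockU) (st (encode_nat n ++ y') o 0 v' k)
    (4 * n + 3) tt (st y' o n v' k).
  apply: does_ext (does_read_nat _ _ _ _ _ _) _; apply: stacks_ext => b.
  by rewrite triple_updU /= addn0.
have readV n u' y' : does (read_nat blockV) (st (encode_nat n ++ y') o u' 0 k)
    (4 * n + 3) tt (st y' o u' n k).
  apply: does_ext (does_read_nat _ _ _ _ _ _) _; apply: stacks_ext => b.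
  by rewrite triple_updV /= addn0.
have incU u' v' y' : does (push L (inl blockU) true) (st y' o u' v' k) 1 tt
    (st y' o u'.+1 v' k).
  by apply: does_ext (does_push_block _ _ _ _ _) _; apply/stacks_ext/triple_updU.
have incV u' v' y' : does (push L (inl blockV) true) (st y' o u' v' k) 1 tt
    (st y' o u' v'.+1 k).
  by apply: does_ext (does_push_block _ _ _ _ _) _; apply/stacks_ext/triple_updV.
have incE o' y' : does (push L (inl blockE) true) (st y' o' 0 0 k) 1 tt
    (st y' o' 0 0 k.+1).
  by apply: does_ext (does_push_block _ _ _ _ _) _; apply/stacks_ext/triple_updE.
have clearU o' u' v' y' : does (clear blockU) (st y' o' u' v' k)
    (4 * u' + 3) tt (st y' o' 0 v' k).
  by apply: does_ext (does_clear _ _ _ _ _) _; apply/stacks_ext/triple_updU.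
have clearV o' u' v' y' : does (clear blockV) (st y' o' u' v' k)
    (4 * v' + 3) tt (st y' o' u' 0 k).
  by apply: does_ext (does_clear _ _ _ _ _) _; apply/stacks_ext/triple_updV.
have emitl := @does_emits l s y o (triple u.+1 v.+1 k) _.
apply: doesW (does_seqf (readU _ _ _) (does_seqf (incU _ _ _)
  (does_seqf (readV _ _ _) (does_seqf (incV _ _ _) (does_seqf (emitl _)
  (does_seqf (clearU _ _ _ _) (does_seqf (clearV _ _ _ _) (incE _ _))))))))
  _ _ => //.
  by case=> [[|[|[|i]]] lti].
by nia.
Qed.

Lemma does_edges s (es : seq (nat * nat)) k o :
  (forall e, e \in es -> (e.1 < s) && (e.2 < s)) -> k + size es <= s ->
  does (while stY (fun=> edge_frag))
    (stacks [::] (flatten (map edge_word es)) (rev o) (triple 0 0 k))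
    ((cost l + 43) * s.+1 * size es + 3) tt
    (stacks [::] [::] (rev (o ++ edges_out k es)) (triple 0 0 (k + size es))).
Proof.
elim: es k o => [|[u v] es IH] k o es_s /= kes.
  rewrite addn0 cats0.
  by apply: doesW (does_while_nil _ _) _ _ => //; lia.
have /andP[/= us vs] := es_s _ (mem_head _ _).
rewrite catA -(addSnnS k).
(* The loop itself has popped the leading [false], so the body starts at the two unary numbers. *)
have dE : does edge_frag (upd
    (stacks [::] (edge_word (u, v) ++ flatten (map edge_word es)) (rev o)
       (triple 0 0 k)) stY
    (encode_nat u ++ encode_nat v ++ flatten (map edge_word es)))
    ((cost l + 40) * s.+1) tt
    (stacks [::] (flatten (map edge_word es))
       (rev (o ++ flatten (map (instr_out (triple u.+1 v.+1 k)) l)))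
       (triple 0 0 k.+1)).
  by apply: does_pre (does_edge _ _ _ _ _) _ => // [|i]; [lia|rewrite upd_stY].
apply: doesW (does_while_cons _ dE (IH _ _ _ _)) _ _ => //.
- by rewrite /= catA.
- by move=> e ees; apply: es_s; rewrite inE ees orbT.
- by rewrite addSnnS.
- by rewrite [X in _ <= X + 3]mulnS; lia.
Qed.

(** The number of variables is written while the input moves from [stX] to [stY], with [C] units per
    bit; the move also undoes the reversal of the input. The edge register then starts at [n.+1],
    past the vertex blocks. *)
Definition gadget_frag : frag unit :=
  seqf (while stX (fun c =>
          seqf (push L stY c) (pushes _ stO (nseq C true))))
  (seqf (pushes _ stO (encode_nat C.+1))
  (seqf (read_nat blockE) (seqf (push L (inl blockE) true)
  (while stY (fun=> edge_frag))))).

Lemma does_gadget n (es : seq (nat * nat)) (w := graph_word n es) :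
  graph_ok n es ->
  exists z,
  does gadget_frag (stacks (rev w) [::] [::] (fun=> 0))
    ((cost l + C + 60) * (size w).+2 ^ 2) tt z /\
  z stO = rev (encode_nat (C * size w + C.+1) ++ edges_out n.+1 es).
Proof.
move=> es_n.
have size_w : n + 1 + 3 * size es <= size w := size_graph_word n es.
exists (stacks [::] [::]
   (rev (encode_nat (C * size w + C.+1) ++ edges_out n.+1 es))
   (triple 0 0 (n.+1 + size es))); split=> //.
(* Generalised over the part already moved; the end of [w1] is the top of [stX], hence the induction
   from the right. *)
have copy w1 w2 o a :
    does (while stX (fun c =>
          seqf (push L stY c) (pushes _ stO (nseq C true))))
      (stacks (rev w1) w2 (rev o) a) ((C + 5) * size w1 + 3) tt
      (stacks [::] (w1 ++ w2) (rev (o ++ nseq (C * size w1) true)) a).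
  elim/last_ind: w1 w2 o => [|w1 c IH] w2 o.
    rewrite !muln0 cats0.
    exact: does_while_nil.
  rewrite rev_rcons size_rcons cat_rcons.
  have dC : does (seqf (push L stY c) (pushes L stO (nseq C true)))
      (stacks (rev w1) w2 (rev o) a) (C + 2) tt
      (stacks (rev w1) (c :: w2) (rev (o ++ nseq C true)) a).
    apply: doesW (does_seqf (does_push _ _ _ _)
      (does_pre (does_pushes_out _ _ _ _ _) _)) _ _ => [i||i//].
      by rewrite upd_stY.
    by rewrite size_nseq; lia.
  apply: doesW (does_while_X (body := fun c => _) dC (IH _ _)) _ _.
    by lia.
  by rewrite -catA -nseqD mulnS.
have E0 : (fun=> 0) =1 triple 0 0 0 by case=> [[|[|[|i]]] lti].
have dE n' y o : does (read_nat blockE)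
    (stacks [::] (encode_nat n' ++ y) o (triple 0 0 0)) (4 * n' + 3) tt
    (stacks [::] y o (triple 0 0 n')).
  apply: does_ext (does_read_nat _ _ _ _ _ _) _; apply: stacks_ext => b.
  by rewrite triple_updE /= addn0.
have incE n' y o : does (push L (inl blockE) true)
    (stacks [::] y o (triple 0 0 n')) 1 tt (stacks [::] y o (triple 0 0 n'.+1)).
  by apply: does_ext (does_push_block _ _ _ _ _) _; apply/stacks_ext/triple_updE.
have loop o := @does_edges (size w).+1 es n.+1 o _ _.
have := copy w [::] [::] (triple 0 0 0); rewrite cats0 => {}copy.
apply: does_pre (stacks_ext _ _ _ E0).
apply: doesW (does_seqf copy (does_seqf (does_pushes_out _ _ _ _ _)
  (does_seqf (dE _ _ _) (does_seqf (incE _ _ _) (loop _ _ _))))) _ _.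
- by move=> e /es_n; lia.
- by lia.
- by rewrite size_rcons size_nseq; nia.
- by move=> i; rewrite /encode_nat nseqD rcons_cat.
Qed.

End Gadget.

(** * Running a given machine and passing on its output *)

Section Pipeline.

Variable M : machine.

Notation K := (tapes M + stackId)%type.

Definition of_machine : fragment K unit :=
  @Fragment K unit (state M) (start M) (fun s h =>
    if delta s [ffun i => h (inl i)] is Some (q, a) then
      (inl q, [ffun i => match i with inl t => a t | inr _ => (h i, Stay) end])
    else (inr tt, idle h)).

Definition restrict (T : memory K) : {ffun tapes M -> tape} :=
  [ffun i => T (inl i)].

(** The additional step is the exit from the fragment. An early halt only shortens the execution,
    since [run] then stays put. *)
Lemma steps_of_machine n s T : halted (run n (s, restrict T)) ->
  exists m T', [/\ m <= n.+1, @steps K unit of_machine s T m tt T',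
    restrict T' = (run n (s, restrict T)).2 &
    forall j, T' (inr j) = T (inr j)].
Proof.
have scanE U : [ffun i => Defs.thead ((restrict U) i)] =
    [ffun i => scan U (inl i)] :> {ffun tapes M -> cell}.
  by apply/ffunP=> i; rewrite !ffunE.
elim: n s T => [|n IH] s T.
  rewrite /halted /run /= /step /= scanE.
  case Ed: (delta _ _) => [[q a]|] // _; exists 1, T; split=> //.
  rewrite -[T in steps _ _ _ _ T]act_idle.
  by apply: StepsExit; rewrite /= Ed.
rewrite /run iterSr -[iter n _ _]/(run n _) {1 2}/step /= scanE.
case Ed: (delta _ _) => [[q a]|] /=; last first.
  move=> H; have [m [T' [mn FT rT T'T]]] := IH s T H.
  by exists m, T'; split=> //; apply: leq_trans mn _.
set T1 := act [ffun i => match i with inl t => a t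
  | inr _ => (scan T i, Stay) end] T.
have -> : [ffun i => update_tape (a i).1 (a i).2 (restrict T i)] = restrict T1.
  by apply/ffunP=> i; rewrite !ffunE.
move=> /IH[m [T' [mn FT rT T'T]]]; exists m.+1, T'; split=> // [|j].
  by apply: StepsNext FT; rewrite /= Ed.
by rewrite T'T !ffunE /=; case: (T (inr j)).
Qed.

(** Writing a bit and moving right pushes it onto [stX] and also advances the head of the output
    tape; the word arrives reversed on the stack. *)
Definition copy_step (h : {ffun K -> cell}) :
    option unit * {ffun K -> cell * direction} :=
  if h (inl (output_tape M)) is Some b then
    (None, [ffun i => if (i == inl (output_tape M)) || (i == inr stX)
                      then (Some b, MoveR) else (h i, Stay)])
  else (Some tt, idle h).

Definition copy_output : fragment K unit := repeat (prim copy_step).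

Definition read_tape (t : tape) : word := read (Defs.thead t :: tright t).

Lemma exec_copy_output T x y o a : stores T (stacks x y o a) ->
  let w := read_tape (T (inl (output_tape M))) in
  exists T', exec copy_output T (size w).+1 tt T' /\
    stores T' (stacks (rev w ++ x) y o a).
Proof.
move Ew: (read_tape _) => w Tx /=; elim: w T x Ew Tx => [|b w IH] T x.
  rewrite /read_tape /=; case ET: (Defs.thead _) => [//|] _ Tx.
  exists T; split=> //; apply: exec_repeat_exit.
  have := exec_prim copy_step T.
  by rewrite /copy_step ffunE ET /= act_idle.
rewrite /read_tape /=; case ET: (Defs.thead _) => [c|//] [cb Ew] Tx.
rewrite {}cb in ET; have := exec_prim copy_step T.
rewrite {2 3}/copy_step ffunE ET [(_, _).1]/= [(_, _).2]/=.
set T1 := act _ T => step1.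
have Ew1 : read_tape (T1 (inl (output_tape M))) = w.
  rewrite !ffunE eqxx /= -Ew /read_tape /=.
  by case: (tright _).
have T1x : stores T1 (stacks (b :: x) y o a).
  move=> j; have [k [l Ej]] := Tx j.
  rewrite !ffunE /=; case: (eqVneq j stX) Ej => [-> | jX] Ej; last first.
    rewrite ifN /=; last by apply: contra_neq jX => -[].
    rewrite ?ffunE Ej -(upd_stX x y o a (b :: x)) /upd (negPf jX).
    by exists k, l.
  by rewrite eqxx /= Ej /=; exists k, l.-1; case: l {Ej}.
have [T' [FT T'w]] := IH _ _ Ew1 T1x.
exists T'; split; last by rewrite rev_cons cat_rcons.
exact: (exec_repeat_next step1 FT).
Qed.

(** The output is read rightwards from the head, whereas a stack leaves the head past its top. The
    head therefore runs back to the blank before the word and steps right once. *)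
Definition rewind_step (h : {ffun K -> cell}) :
    option unit * {ffun K -> cell * direction} :=
  if h (inr stO) is Some b then (None, move_on stO (Some b, MoveL) h)
  else (Some tt, move_on stO (None, MoveR) h).

Definition rewind : fragment K unit :=
  seqf (prim (fun h : {ffun K -> cell} => (tt, move_on stO (None, MoveL) h)))
    (repeat (prim rewind_step)).

Lemma exec_rewind (T : memory K) w : is_stack (T (inr stO)) (rev w) ->
  exists T' : memory K, exec rewind T (size w).+2 tt T' /\
    read_tape (T' (inr stO)) = w.
Proof.
move=> [k [l ET]]; pose p (h : {ffun K -> cell}) := (tt, move_on stO (None, MoveL) h).
have := exec_prim p T; rewrite {2 3}/p /=; set T1 := act _ T => step1.
(* Here [s] lists the bits from the head leftwards, and [r] the cells to the right of the head. *)
have back s r (U : memory K) : 0 < size r ->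
    U (inr stO) = (let X := map Some s ++ nseq k None in
      Tape (behead X) (head None X) r) ->
    exists T' : memory K, exec (repeat (prim rewind_step)) U (size s).+1 tt T' /\
      read_tape (T' (inr stO)) = rev s ++ read r.
  elim: s r U => [|b s IH] r U r0 EU; have := exec_prim rewind_step U.
    have hN : scan U (inr stO) = None by rewrite ffunE EU /=; case: k {ET EU}.
    rewrite {2 3}/rewind_step hN /=; set U1 := act _ _ => step2.
    exists U1; split; first exact: exec_repeat_exit.
    by rewrite act_move_on eqxx EU /=; case: r r0 {EU}.
  have hS : scan U (inr stO) = Some b by rewrite ffunE EU.
  rewrite {2 3}/rewind_step hS /=; set U1 := act _ _ => step2.
  have [//||T' [FT rT']] := IH (Some b :: r) U1.
    by rewrite act_move_on eqxx EU /=.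
  exists T'; split; first exact: (exec_repeat_next step2 FT).
  by rewrite rT' /= rev_cons cat_rcons.
have [//||T' [FT rT']] := back (rev w) (None :: nseq l None) T1.
  by rewrite act_move_on eqxx ET.
rewrite size_rev in FT; exists T'; split.
  exact: (exec_seqf step1 FT).
by rewrite rT' revK cats0.
Qed.

End Pipeline.

(** * Polynomial time of the composite machine *)

Definition tape_size (t : tape) : nat := size (tleft t) + size (tright t).

(** One step adds at most one cell, so running times bound the lengths of intermediate words. *)
Lemma exec_tape_size (K : finType) E (F : fragment K E) T n e T' i :
  exec F T n e T' -> tape_size (T' i) <= tape_size (T i) + n.
Proof.
have actS a U : tape_size (act a U i) <= (tape_size (U i)).+1.
  rewrite ffunE; case: (a i) (U i) => c [] [[|x xs] h [|y ys]];
    rewrite /tape_size /=; lia.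
rewrite /exec; elim=> {n e T'}[s U e a _|s U s' a n e T' _ _ IH].
  by rewrite addn1.
by rewrite addnS -addSn; apply: leq_trans IH _; rewrite leq_add2r.
Qed.

Lemma size_read_tape t : size (read_tape t) <= (tape_size t).+1.
Proof.
have size_read s : size (read s) <= size s by elim: s => // -[].
by apply: leq_trans (size_read _) _; rewrite /tape_size /= ltnS leq_addl.
Qed.

Section Reduction.

Variables (M : machine) (C : nat) (l : seq instr).

Definition gadget_word n es : word :=
  encode_nat (C * size (graph_word n es) + C.+1) ++ edges_out C l n.+1 es.

Definition reduction_machine : machine :=
  machine_of (inl (input_tape M)) (inr stO)
    (seqf (of_machine M) (seqf (copy_output M)
      (seqf (gadget_frag (tapes M) C l) (rewind M)))).

Lemma run_reduction x n es t D N : graph_ok n es ->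
  halted (run t (initial M x)) ->
  output (run t (initial M x)) = graph_word n es ->
  D = cost C l + C + 60 -> (2 * D + 10) * (size x + t + 4) ^ 2 <= N ->
  let c := run N (initial reduction_machine x) in
  halted c /\ output c = gadget_word n es.
Proof.
move=> es_n halt_x out_x eD boundN /=.
pose T0 : memory (tapes M + stackId)%type := (initial reduction_machine x).2.
have rT0 : restrict T0 = (initial M x).2.
  by apply/ffunP=> i; rewrite !ffunE; congr (if _ then _ else _).
have T0inr j : T0 (inr j) = Tape [::] None [::] by rewrite ffunE.
have [m1 [T1 [m1t FT1 rT1 T1inr]]] :
    exists m T', [/\ m <= t.+1, exec (of_machine M) T0 m tt T',
      restrict T' = (run t (initial M x)).2 &
      forall j, T' (inr j) = T0 (inr j)].
  have := @steps_of_machine M t (start M) T0.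
  by rewrite rT0; apply.
have {}out_x : read_tape (T1 (inl (output_tape M))) = graph_word n es.
  by rewrite -out_x /output -rT1 !ffunE.
have st1 : stores T1 (stacks [::] [::] [::] (fun=> 0)).
  move=> j; rewrite T1inr T0inr; exists 0, 0.
  by case: j => [b|[[|[|[|i]]] lti]].
have [T2 [FT2 st2]] := exec_copy_output st1.
rewrite out_x cats0 in FT2 st2.
have [z [[dG] zO]] := @does_gadget (tapes M) C l n es es_n.
have {dG}[m3 [T3 [m3D FT3 st3]]] := dG _ st2.
have [|T4 [FT4 out4]] := @exec_rewind M T3 (gadget_word n es).
  by rewrite /gadget_word -zO.
have FT := exec_seqf FT1 (exec_seqf FT2 (exec_seqf FT3 FT4)).
have size_w : size (graph_word n es) <= size x + t + 2.
  rewrite -out_x; apply: leq_trans (size_read_tape _) _.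
  have := exec_tape_size (inl (output_tape M)) FT1.
  have : tape_size (T0 (inl (output_tape M))) <= size x.
    rewrite ffunE; case: ifP => _ //; case: (x) => //= b y.
    by rewrite /tape_size /= size_map.
  move=> le0 le1; apply: leq_ltn_trans le1 _.
  by apply: leq_ltn_trans (leq_add le0 m1t) _; lia.
(* The rewinding time depends on the length of the output, which is bounded by the running time of
   the first three phases. *)
have size_o : size (gadget_word n es) <= m1 + ((size (graph_word n es)).+1 + m3).
  have := exec_tape_size (inr stO)
    (exec_seqf FT1 (exec_seqf FT2 FT3)).
  rewrite T0inr add0n; apply: leq_trans.
  have [k [k' ->]] := st3 stO.
  by rewrite zO /tape_size /= [X in _ <= X + _]size_cat size_map size_rev -addnA leq_addr.
have leN : m1 + ((size (graph_word n es)).+1 + (m3 + (size (gadget_word n es)).+2)) <= N.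
  apply: leq_trans boundN; rewrite -eD in m3D.
  have le2 : (size (graph_word n es)).+2 ^ 2 <= (size x + t + 4) ^ 2.
    by rewrite leq_exp2r //; lia.
  have {le2}m3D2 := leq_trans m3D (leq_mul (leqnn D) le2).
  have leS : size x + t + 4 <= (size x + t + 4) ^ 2.
    by rewrite -[X in X <= _]expn1 leq_pexp2l // addn_gt0 orbT.
  rewrite mulnDl -mulnA; move: (_ ^ 2) m3D2 leS => q; move: (D * q) => r.
  by move: size_w size_o m1t; clear; lia.
rewrite [initial _ _]surjective_pairing (run_machine_of _ _ FT leN).
by split=> //; rewrite -out4.
Qed.

End Reduction.

Lemma polytime_reduction C l f : polytime f ->
  (forall x, exists n es, graph_ok n es /\ f x = graph_word n es) ->
  exists g, polytime g /\ forall x n es, graph_ok n es ->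
    f x = graph_word n es -> g x = gadget_word C l n es.
Proof.
move=> [M [a [d fM]]] f_graph.
pose D := cost C l + C + 60.
pose bound n := (2 * D + 10) * (n + (a * n ^ d + a) + 4) ^ 2.
(* With [p = n ^ d.+1], both [n] and [n ^ d] are at most [p + 1], so the base of the square in
   [bound] is at most [A * (p + 1)]; moreover [(p + 1) ^ 2 <= 4 * (p ^ 2 + 1)]. *)
pose A := 2 * a + 5.
pose a' := (2 * D + 10) * (4 * A ^ 2); pose d' := 2 * d.+1.
have bound_le n : bound n <= a' * n ^ d' + a'.
  have le1 : n ^ d <= n ^ d.+1 + 1.
    case: n => [|n]; first by case: (d) => // k; rewrite exp0n.
    by rewrite (leq_trans _ (leq_addr _ _)) // leq_pexp2l.
  have le2 : n <= n ^ d.+1 + 1.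
    case: n {le1} => // n.
    by rewrite (leq_trans _ (leq_addr _ _)) // -[X in X <= _]expn1 leq_pexp2l.
  rewrite -mulnSr /bound /a' /d' [2 * d.+1]mulnC expnM -[X in _ <= X]mulnA.
  rewrite leq_mul2l; apply/orP; right.
  move: (n ^ d.+1) (n ^ d) le1 le2 => p q le1 le2.
  have le3 : n + (a * q + a) + 4 <= A * (p + 1) by rewrite /A; nia.
  apply: (@leq_trans ((A * (p + 1)) ^ 2)); first by rewrite leq_exp2r.
  by rewrite expnMn; nia.
pose R := reduction_machine M C l.
pose g x := output (run (a' * size x ^ d' + a') (initial R x)).
have gP x n es : graph_ok n es -> f x = graph_word n es ->
    let c := run (a' * size x ^ d' + a') (initial R x) in
    halted c /\ output c = gadget_word C l n es.
  move=> es_n fx; have [haltx outx] := fM x.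
  apply: run_reduction (bound_le _) => //.
  by rewrite outx.
exists g; split=> [|x n es es_n fx]; last by have [] := gP x n es es_n fx.
exists R, a', d' => x; split=> //.
by have [n [es [es_n /(gP _ _ _ es_n)[]]]] := f_graph x.
Qed.

(** * The instance built from a graph *)

Section Instance.

Variables (sg : signature) (A B : structure sg).

Notation sextuple := (6.-tuple A).

Definition tupU (x y z : A) : sextuple := [tuple x; y; x; z; y; z].
Definition tupV (x y z : A) : sextuple := [tuple y; x; z; x; z; y].

Definition slots : nat := #|{: sextuple}|.

(* A variable is a block number and a slot in this block.  Block [0] is shared by
   the constant tuples, block [v.+1] holds the triples [(x, y, z)] of the vertex
   [v], stored as [tupU x y z], and the blocks from [n.+1] on belong to the edges.
   The number of variables is bounded in terms of the length of the input, because
   it has to be written before the edges are read; the spare ones are isolated. *)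
Definition place (p : sextuple) : option blockId * sextuple :=
  let c i := nth (thead p) p i in
  if p == tupU (c 0) (c 0) (c 0) then (None, p)
  else if p == tupU (c 0) (c 1) (c 3) then (Some blockU, p)
  else if p == tupV (c 1) (c 0) (c 2) then
    (Some blockV, tupU (c 1) (c 0) (c 2))
  else (Some blockE, p).

Definition block (a : blockId -> nat) (p : sextuple) : nat :=
  oapp a 0 (place p).1.

Definition slot (p : sextuple) : nat := enum_rank (place p).2.

Definition pos (a : blockId -> nat) (p : sextuple) : nat :=
  slots * block a p + slot p.

Definition pos_instrs (p : sextuple) : seq instr :=
  rcons (if (place p).1 is Some b then [:: inr b] else [::])
    (inl (encode_nat (slot p))).

Definition template := {R : sg & (arity R).-tuple sextuple}.

(** These facts form one copy of the sixth power; each edge repeats them with its own block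
    numbers. *)
Definition templates : seq template :=
  enum [pred f : template | tagged f \in interp (power A 6) (tag f)].

Definition template_instrs (f : template) : seq instr :=
  inl (encode_nat (enum_rank (tag f))) ::
  flatten (map pos_instrs (tagged f)).

Definition instrs : seq instr := flatten (map template_instrs templates).

Definition instantiate N (a : blockId -> nat) (f : template) : fact sg N.+1 :=
  Tagged (fun R => (arity R).-tuple 'I_N.+1)
    (map_tuple (fun p => inord (pos a p)) (tagged f)).

Definition labels k (e : nat * nat) : blockId -> nat := triple e.1.+1 e.2.+1 k.

Fixpoint gadget N k (es : seq (nat * nat)) : seq (fact sg N.+1) :=
  if es is e :: es' then
    map (instantiate N (labels k e)) templates ++ gadget N k.+1 es'
  else [::].

Lemma slot_lt p : slot p < slots.
Proof. exact: ltn_ord. Qed.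

Lemma pos_lt a p m : (forall b, a b <= m) -> pos a p < slots * m.+1.
Proof.
move=> am; rewrite /pos mulnS addnC -addSn leq_add ?slot_lt // leq_mul //.
by rewrite /block; case: (place p).1.
Qed.

Lemma pos_instrsP a p :
  flatten (map (instr_out slots a) (pos_instrs p)) = encode_nat (pos a p).
Proof.
rewrite /pos_instrs /pos /block; case: (place p).1 => [b|] /=.
  by rewrite cats0 /encode_nat nseqD rcons_cat.
by rewrite muln0 cats0.
Qed.

Lemma encode_instantiate N a f : (forall p, pos a p <= N) ->
  flatten (map encode_nat (encode_fact (instantiate N a f))) =
  flatten (map (instr_out slots a) (template_instrs f)).
Proof.
move=> aN; rewrite /= -!map_comp; congr (_ ++ _).
elim: (tval (tagged f)) => //= p s ->.
by rewrite map_cat flatten_cat pos_instrsP inordK // ltnS.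
Qed.

Lemma encode_instantiations N a (s : seq template) :
  (forall p, pos a p <= N) ->
  flatten (map encode_nat
    (flatten (map (@encode_fact sg N.+1) (map (instantiate N a) s)))) =
  flatten (map (instr_out slots a) (flatten (map template_instrs s))).
Proof.
move=> aN; elim: s => [//|f s IH].
rewrite (_ : flatten _ = encode_fact (instantiate N a f) ++
  flatten (map (@encode_fact sg N.+1) (map (instantiate N a) s))) //.
rewrite (_ : flatten (map template_instrs _) = template_instrs f ++
  flatten (map template_instrs s)) //.
by rewrite map_cat flatten_cat IH map_cat flatten_cat encode_instantiate.
Qed.

Lemma encode_gadget N m k es : graph_ok m es -> k + size es <= N ->
  m <= N ->
  let M := slots * N + slots in
  encode (gadget M k es) = encode_nat M.+1 ++ edges_out slots instrs k es.
Proof.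
move=> es_m kN mN M; rewrite -[LHS]/(encode_nat M.+1 ++ flatten (map encode_nat
  (flatten (map (@encode_fact sg M.+1) (gadget M k es))))).
congr (_ ++ _); elim: es k es_m kN => [//|e es IH] k es_m kN.
rewrite [gadget _ _ _]/= map_cat flatten_cat map_cat flatten_cat IH; first last.
- by rewrite addSnnS.
- by move=> e' e'es; apply: es_m; rewrite inE e'es orbT.
rewrite encode_instantiations // => p.
have /andP[e1 e2] := es_m _ (mem_head _ _).
rewrite /M -mulnSr ltnW // pos_lt // => -[[|[|[|i]]] lti] //=.
- exact: leq_trans e1 mN.
- exact: leq_trans e2 mN.
- by apply: leq_trans kN; apply: leq_addr.
Qed.

Lemma mem_gadget N k es c :
  c \in gadget N k es <-> exists i f, [/\ i < size es, f \in templates &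
    c = instantiate N (labels (k + i) (nth (0, 0) es i)) f].
Proof.
elim: es k => [|e es IH] k /=; first by split=> // -[i [f []]].
rewrite mem_cat; split=> [/orP[/mapP[f fT ->]|/IH[i [f [ies fT ->]]]]|].
- by exists 0, f; rewrite addn0.
- by exists i.+1, f; rewrite addnS.
case=> -[|i] [f [ies fT Ec]]; apply/orP; [left | right].
  by rewrite Ec addn0; apply: map_f.
by apply: (IH _).2; exists i, f; rewrite addSnnS.
Qed.

(** Only constant tuples have both shapes. Since these go to a shared block, the two identifications
    made for an edge never chain. *)
Lemma tupV_eqU x y z u v w : tupV x y z = tupU u v w -> x = z /\ y = z.
Proof. by move=> /(congr1 val)[]; split; congruence. Qed.

(** The right-hand side mentions only the block of the first end; with the next lemma, all edges at
    a vertex share the variables of its triples. *)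
Lemma pos_tupU a x y z : pos a (tupU x y z) = pos (fun=> a blockU) (tupU x y z).
Proof. by rewrite /pos /block /slot /place /=; case: ifP => // _; rewrite eqxx. Qed.

Lemma pos_tupV a x y z : pos a (tupV x y z) = pos (fun=> a blockV) (tupU x y z).
Proof.
have [/andP[/eqP <- /eqP <-]|xyz] := boolP ((x == y) && (y == z)).
  by rewrite /pos /block /slot /place /= !eqxx.
(* A non-constant [tupV] fails the first two tests of [place], and the third recovers its triple. *)
have nU u v w : (tupV x y z == tupU u v w) = false.
  by apply: contraNF xyz => /eqP/tupV_eqU[-> ->]; rewrite eqxx.
have nC u : (tupU x y z == tupU u u u) = false.
  apply: contraNF xyz => /eqP/(congr1 val)[-> -> _ -> _ _].
  by rewrite !eqxx.
by rewrite /pos /block /slot /place /= !nU !nC !eqxx.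
Qed.

(** * Completeness: a 3-colouring yields projections to [A] *)

Section Completeness.

Variables (n : nat) (es : seq (nat * nat)) (col : nat -> 'I_3) (a0 : A).

Hypothesis es_n : graph_ok n es.
Hypothesis col_es : forall e, e \in es -> col e.1 != col e.2.

(* The coordinates of a sextuple correspond to the ordered pairs of distinct
   colours [(0,1), (1,0), (0,2), (2,0), (1,2), (2,1)]. *)
Definition vertex_coord (i : 'I_3) : nat := nth 0 [:: 0; 1; 3] i.

Definition edge_coord (i j : 'I_3) : nat :=
  nth 0 (nth [::] [:: [:: 0; 0; 2]; [:: 1; 0; 4]; [:: 3; 5; 0]] i) j.

(** Block [0] holds constant tuples, so any coordinate will do there. Vertex [v] has block [v.+1],
    and edge number [i] has block [n.+1 + i]. *)
Definition block_coord (b : nat) : nat :=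
  if b == 0 then 0
  else if b <= n then vertex_coord (col b.-1)
  else let e := nth (0, 0) es (b - n.+1) in edge_coord (col e.1) (col e.2).

Definition decode (i : nat) : A :=
  nth a0 (nth [tuple of nseq 6 a0] (enum {: sextuple}) (i %% slots))
    (block_coord (i %/ slots)).

Lemma decode_pos a p :
  decode (pos a p) = nth a0 (place p).2 (block_coord (block a p)).
Proof.
have s0 : 0 < slots by apply: leq_trans (slot_lt p).
rewrite /decode /pos mulnC divnMDl // (divn_small (slot_lt p)) addn0.
rewrite modnMDl modn_small ?slot_lt // /slot.
by rewrite nth_enum_rank.
Qed.

(** In the list of colour pairs, the first entries [0], [1], [2] mark the coordinates where [tupU]
    holds [x], [y], [z]; the second entries do the same for [tupV]. *)
Lemma edge_coordU (i j : 'I_3) x y z : i != j ->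
  nth a0 (tupU x y z) (edge_coord i j) = nth a0 (tupU x y z) (vertex_coord i).
Proof. by case: i j => [[|[|[|i]]] lti] [[|[|[|j]]] ltj]. Qed.

Lemma edge_coordV (i j : 'I_3) x y z : i != j ->
  nth a0 (tupV x y z) (edge_coord i j) = nth a0 (tupU x y z) (vertex_coord j).
Proof. by case: i j => [[|[|[|i]]] lti] [[|[|[|j]]] ltj]. Qed.

Lemma edge_coord_lt (i j : 'I_3) : edge_coord i j < 6.
Proof. by case: i j => [[|[|[|i]]] lti] [[|[|[|j]]] ltj]. Qed.

(** Identified tuples take their values from the vertex blocks, whose coordinates agree with that of
    the edge because its ends have different colours; a constant tuple has the same entry
    everywhere. *)
Lemma decode_edge i p : i < size es ->
  let e := nth (0, 0) es i in
  decode (pos (labels (n.+1 + i) e) p) =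
  nth a0 p (edge_coord (col e.1) (col e.2)).
Proof.
move=> ies e; have ees : e \in es by apply: mem_nth.
have /andP[e1 e2] := es_n ees; have ce := col_es ees.
rewrite decode_pos /block /place; case: eqP => [->|_] /=.
  rewrite /block_coord /=.
  by case: (edge_coord _ _) (edge_coord_lt (col e.1) (col e.2))
    => [|[|[|[|[|[|k]]]]]].
case: eqP => [->|_] /=.
  by rewrite /labels /triple /block_coord /= e1 edge_coordU.
case: eqP => [Ep|_] /=.
  by rewrite /labels /triple /block_coord /= e2 Ep edge_coordV.
rewrite /labels /triple /block_coord /= addSn ltnNge leq_addr /=.
by rewrite subSS addKn.
Qed.

Lemma gadget_complete N :
  (forall i p, i < size es ->
     pos (labels (n.+1 + i) (nth (0, 0) es i)) p <= N) ->
  maps_to (structure_of_facts (gadget N n.+1 es)) A.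
Proof.
move=> posN; exists (fun i : 'I_N.+1 => decode i) => R t.
pose good (c : fact sg N.+1) :=
  map_tuple (fun i : 'I_N.+1 => decode i) (tagged c) \in interp A (tag c).
rewrite inE => /mem_gadget[i [f [ies fT Et]]].
rewrite -[_ \in _]/(good (Tagged _ t)) {}Et /good /=.
move: fT; rewrite mem_enum !inE => /forallP.
(* A fact of the power has all its columns in the relation; the column taken is that of the two
   colours of the edge. *)
move=> /(_ (Ordinal (edge_coord_lt
  (col (nth (0, 0) es i).1) (col (nth (0, 0) es i).2)))).
set t1 := map_tuple _ _; set t2 := map_tuple _ (map_tuple _ _).
suff -> : t2 = t1 by [].
apply: val_inj; rewrite /= -map_comp.
apply: eq_map => p /=; rewrite inordK ?ltnS ?posN // decode_edge //.
by rewrite (tnth_nth a0).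
Qed.

End Completeness.

(** * Soundness: a homomorphism to [B] yields a colouring *)

Lemma gadget_sound n (es : seq (nat * nat)) N :
  maps_to (structure_of_facts (gadget N n.+1 es)) B ->
  ~ (exists s : sextuple -> B, Pol s /\ siggers s) ->
  exists col : nat -> {ffun A * A * A -> B},
    forall e, e \in es -> col e.1 != col e.2.
Proof.
move=> [h hom_h] noS.
pose var a p : B := h (inord (pos a p)).
(* A vertex is coloured by the map that [h] induces on its triples. *)
exists (fun v => [ffun t => var (fun=> v.+1) (tupU t.1.1 t.1.2 t.2)]).
move=> e /(nthP (0, 0))[i ies Ei]; apply/eqP => Ecol; apply: noS.
pose a := labels (n.+1 + i) e.
(* The copy of the power at this edge makes [var a] a polymorphism, and equal colours at the two
   ends amount to the Siggers identity. *)
exists (var a); split=> [R t tR | x y z].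
  pose f : template := Tagged (fun R => (arity R).-tuple sextuple) t.
  have -> : map_tuple (var a) t =
      map_tuple h (tagged (instantiate N a f)).
    by apply: val_inj; rewrite /= -map_comp.
  apply: (hom_h R); rewrite inE; apply/mem_gadget; exists i, f.
  by split; rewrite ?Ei // mem_enum inE.
have := congr1 (fun g : {ffun _} => g (x, y, z)) Ecol.
rewrite !ffunE => Exyz.
rewrite -[LHS]/(var a (tupU x y z)) -[RHS]/(var a (tupV x y z)).
by rewrite /var pos_tupU pos_tupV.
Qed.

End Instance.

(** * Graphs as instances over [K c] *)

Section Graphs.

Variables (n : nat) (s : seq (fact graph_sig n)).

Definition ends (c : fact graph_sig n) : 'I_n * 'I_n :=
  let t : 2.-tuple 'I_n := tagged c in (tnth t ord0, tnth t ord_max).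

Definition edges : seq (nat * nat) :=
  map (fun c => (val (ends c).1, val (ends c).2)) s.

Lemma edges_ok : graph_ok n edges.
Proof. by move=> _ /mapP[c _ ->] /=; rewrite !ltn_ord. Qed.

Lemma encode_graph : encode s = graph_word n edges.
Proof.
pose E (s' : seq (fact graph_sig n)) :=
  flatten (map encode_nat (flatten (map (@encode_fact graph_sig n) s'))).
rewrite -[LHS]/(encode_nat n ++ E s) /graph_word /edges; congr (_ ++ _).
elim: s => [//|c s' IH].
have -> : E (c :: s') = flatten (map encode_nat (encode_fact c)) ++ E s'.
  by rewrite /E -flatten_cat -map_cat.
rewrite {}IH; set t := flatten (map edge_word _).
rewrite -[RHS]/(edge_word (val (ends c).1, val (ends c).2) ++ t).
congr (_ ++ _).
have enum0 : enum_rank tt = 0 :> nat.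
  by have := ltn_ord (enum_rank tt); rewrite [X in _ < X]card_unit; case: (nat_of_ord _).
case: c => [[] [[|u [|v []]] //= sz]].
by rewrite enum0 cats0.
Qed.

Lemma graph_homP c (f : 'I_n -> 'I_c) :
  @is_hom _ (structure_of_facts s) (K c) f <->
  forall x, x \in s -> f (ends x).1 != f (ends x).2.
Proof.
split=> [hom_f [[] t] ts | fs [] t].
  have := hom_f tt t; rewrite !inE => /(_ ts).
  by rewrite !tnth_map.
by rewrite !inE => /fs; rewrite !tnth_map.
Qed.

End Graphs.

(** * Transfer of hardness and the equivalences *)

Lemma NP_hard_reduction (sg : signature) (A B : structure sg) :
  ~ (exists s : 6.-tuple A -> B, Pol s /\ siggers s) -> maps_to A B ->
  (forall c, 3 <= c -> NP_hard (PCSP (K 3) (K c))) -> NP_hard (PCSP A B).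
Proof.
move=> noS [AB homAB] hard L NP_L.
(* If [A] is empty, the Siggers identity is vacuous, and [AB] after [thead] is a polymorphism: only
   nullary relations have tuples to check. *)
have [a0 _ | A0] := pickP (fun _ : A => true); last first.
  case: noS; exists (fun p => AB (thead p)); split=> [R t tR | x]; last first.
    by have := A0 x.
  case: (posnP (arity R)) => [ar0 | ar0]; last first.
    by have := A0 (thead (tnth t (Ordinal ar0))).
  have [ft ftR] : exists2 u, u \in interp A R &
      map_tuple (fun p : power A 6 => AB (thead p)) t = map_tuple AB u.
    move: tR; rewrite inE => /forallP/(_ ord0); set u := map_tuple _ _ => uR.
    exists u => //; apply: eq_from_tnth => i.
    by have := ltn_ord i; rewrite [X in _ < X]ar0.
  by move=> ->; apply: homAB.
(* One colour for each possible map, plus three, which ensures [3 <= c] and a nonempty ['I_c]. *)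
set c := #|{ffun A * A * A -> B}|.+3.
have [f [poly_f f_yes f_no]] := hard c isT L NP_L.
have f_graph w : exists n es, graph_ok n es /\ f w = graph_word n es.
  (* By excluded middle on [L w]; in either case the promise says that [f w] encodes a graph. *)
  have [/f_yes|/f_no] := classic (L w) => -[n [s [-> _]]];
    by exists n, (edges s); split; [apply: edges_ok | apply: encode_graph].
have [g [poly_g gP]] := polytime_reduction (slots A) (instrs A) poly_f f_graph.
have gE w n (s : seq (fact graph_sig n)) : f w = encode s ->
    g w = encode (gadget A (slots A * size (f w) + slots A) n.+1 (edges s)).
  rewrite encode_graph => fw; rewrite (gP _ _ _ (@edges_ok n s) fw).
  have size_fw : n + 1 + 3 * size (edges s) <= size (f w).
    rewrite fw size_graph_word //.
  rewrite (@encode_gadget _ A _ _ n.+1 _ (@edges_ok n s)); [|lia|lia].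
  by rewrite /gadget_word -fw addnS.
exists g; split=> // w.
  move=> /f_yes[n [s [fw [col /graph_homP col_s]]]].
  exists _, (gadget A (slots A * size (f w) + slots A) n.+1 (edges s)).
  split; first exact: gE.
  (* The colour [ord0] is a default outside the graph; edges only meet vertices below [n]. *)
  pose col' i := if insub i is Some j then col j else ord0.
  apply: (@gadget_complete _ _ n _ col' a0) => [|e|i p ies].
  - exact: edges_ok.
  - by move=> /mapP[x xs ->]; rewrite /col' !valK; apply: col_s.
  have : n + 1 + 3 * size (edges s) <= size (f w).
    by rewrite fw encode_graph size_graph_word.
  set e := nth _ _ _; move=> size_fw.
  have /andP[e1 e2] : (e.1 < n) && (e.2 < n) by exact: (edges_ok (mem_nth _ ies)).
  rewrite -mulnSr ltnW // pos_lt // => -[[|[|[|b]]] ltb] //=;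
    rewrite /labels /triple /=; lia.
move=> /f_no[n [s [fw no_col]]].
exists _, (gadget A (slots A * size (f w) + slots A) n.+1 (edges s)).
split; first exact: gE.
move=> /gadget_sound/(_ noS)[col col_es]; apply: no_col.
(* Numbering the maps turns the colouring of [gadget_sound] into one with [c] colours. *)
pose rank (v : {ffun A * A * A -> B}) : 'I_c := inord (enum_rank v).
have rankK : injective rank.
  have rank_lt (v : {ffun A * A * A -> B}) : enum_rank v < c.
    by apply: leq_trans (ltn_ord _) _; rewrite -[c]addn3 leq_addr.
  move=> u v /(congr1 val); rewrite /= !inordK ?rank_lt //.
  by move=> /ord_inj/enum_rank_inj.
exists (fun v : 'I_n => rank (col v)); apply/graph_homP => x xs.
by rewrite (inj_eq rankK); apply: (col_es (val _, val _)); apply: map_f xs.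
Qed.

Lemma no_siggers_K k c : 3 <= k ->
  ~ (exists s : 6.-tuple (K k) -> K c, Pol s /\ siggers s).
Proof.
case: k => [|[|[|k]]] // _ [s [pol_s sig_s]].
pose x : K k.+3 := @Ordinal k.+3 0 isT.
pose y : K k.+3 := @Ordinal k.+3 1 isT.
pose z : K k.+3 := @Ordinal k.+3 2 isT.
(* The two sides of the Siggers identity at distinct [x], [y], [z] differ in every coordinate, hence
   form an edge of the power. *)
pose t : 2.-tuple (6.-tuple (K k.+3)) :=
  [tuple [tuple x; y; x; z; y; z]; [tuple y; x; z; x; z; y]].
have tR : (t : (arity (tt : graph_sig)).-tuple (power (K k.+3) 6))
    \in interp (power (K k.+3) 6) tt.
  rewrite inE; apply/forallP => j; rewrite inE /= !tnth_map.
  by case: j => [[|[|[|[|[|[|j]]]]]] ltj].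
have := pol_s tt t tR; rewrite inE !tnth_map.
by rewrite -[X in X != _]/(s [tuple x; y; x; z; y; z]) sig_s eqxx.
Qed.

Lemma K_maps_to k c : k <= c -> maps_to (K k) (K c).
Proof.
move=> kc; exists (widen_ord kc) => R t.
by rewrite !inE !tnth_map.
Qed.

Theorem theorem6p9 :
  ((forall (sg : signature) (A B : structure sg),
      maps_to A B ->
      ~ (exists s : 6.-tuple A -> B, Pol s /\ siggers s) ->
      NP_hard (PCSP A B))
   <->
   (forall k c : nat, 3 <= k -> k <= c -> NP_hard (PCSP (K k) (K c))))
  /\
  ((forall k c : nat, 3 <= k -> k <= c -> NP_hard (PCSP (K k) (K c)))
   <->
   (forall c : nat, 3 <= c -> NP_hard (PCSP (K 3) (K c)))).
Proof.
split; split.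
- move=> hard k c k3 kc.
  by apply: hard; [apply: K_maps_to | apply: no_siggers_K].
- move=> hard sg A B AB noS; apply: NP_hard_reduction => // c c3.
  exact: hard.
- by move=> hard c c3; apply: hard.
(* The same reduction works: for yes instances the colouring is composed with the map from [K 3] to
   [K k], and no instances are unchanged. *)
- move=> hard k c k3 kc L.
  move=> /(hard c (leq_trans k3 kc))[f [poly_f f_yes f_no]].
  exists f; split=> // w /f_yes[n [s [fw [col hom_col]]]].
  exists n, s; split=> //; have [i hom_i] := K_maps_to k3.
  exists (i \o col) => R t /hom_col/hom_i.
  set t1 := map_tuple _ _; set t2 := map_tuple _ t; suff -> : t2 = t1 by [].
  by apply: val_inj; rewrite /= -map_comp.
Qed.
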